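(* (Generalized Beppo Levi theorem) Let $(f_n)\subset R_2$ and $f_n\nearrow f$ a.e. If $\int f_n\,dx>-\infty$ for at least one $n$, then $f\in R_2$ and $$\int f_n\,dx\nearrow\int f\,dx.$$
   Context: A set $N\subset\mathbb R$ is a null set if for each $\varepsilon>0$ it has a countable cover by intervals of total length $<\varepsilon$; a property holds almost everywhere (a.e.) if it holds outside a null set. Functions (with values in $[-\infty,\infty]$, defined a.e. on $\mathbb R$) that are equal a.e. are identified. $f_n\nearrow f$ means that $f_n\le f_{n+1}$ for all $n$ and $f_n\to f$, a.e. A step function is a function of the form $\varphi=\sum_{i=1}^m c_i\chi_{I_i}$ with bounded intervals $I_i\subset\mathbb R$ and real numbers $c_i$; its integral is $\int\varphi\,dx:=\sum_{i=1}^m c_i|I_i|$, where $|I_i|$ is the length of $I_i$ (this does not depend on the representation). $R_0$ denotes the vector lattice of step functions. $R_1$ is the class of functions $f:\mathbb R\to[-\infty,\infty]$ for which there exists $(\varphi_n)\subset R_0$ with $\varphi_n\nearrow f$, and then $\int f\,dx:=\lim\int\varphi_n\,dx\in(-\infty,\infty]$ (this does not depend on the choice of $(\varphi_n)$). $R_2$ is the class of functions $f$ which can be written (a.e.) as $f=f_1-f_2$ with $f_1,f_2\in R_1$ such that $\int f_1\,dx-\int f_2\,dx$ is well defined, i.e. at least one of the two integrals is finite (then $f_1-f_2$ is defined a.e.); then $\int f\,dx:=\int f_1\,dx-\int f_2\,dx\in[-\infty,\infty]$ (this does not depend on the choice of $f_1,f_2$). *)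

(* Defs.v *)
From HB Require Import structures.
From mathcomp Require Import all_boot all_order all_algebra.
From mathcomp Require Import all_classical all_reals all_analysis.

Set Implicit Arguments.
Unset Strict Implicit.
Unset Printing Implicit Defensive.

Import Order.TTheory GRing.Theory Num.Theory.
Import numFieldNormedType.Exports.
Local Open Scope classical_set_scope.
Local Open Scope ring_scope.
Local Open Scope ereal_scope.

(* A function defined a.e. is represented by an arbitrary total function
   R -> \bar R: all the notions below that involve such functions depend on
   them only up to equality a.e. *)

(* The endpoints are coerced to \bar R; an interval whose endpoints are not in
   increasing order is empty (or a point) and has length 0. *)
Definition itv_length (R : realType) (i : interval R) : \bar R :=
  if (i.1 : \bar R) < i.2 then (i.2 : \bar R) - i.1 else 0.

(* Finite covers are included, since intervals may be empty. *)
Definition is_null_set (R : realType) (N : set R) : Prop :=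
  forall eps : R, (0 < eps)%R ->
  exists I : nat -> interval R,
    N `<=` \bigcup_k [set` I k] /\
    \sum_(k <oo) itv_length (I k) < eps%:E.

Definition holds_ae (R : realType) (P : R -> Prop) : Prop :=
  is_null_set [set x | ~ P x].

Definition increases_to (R : realType) (u : nat -> \bar R) (l : \bar R) : Prop :=
  (forall n, u n <= u n.+1) /\ u n @[n --> \oo] --> l.

Definition ae_increases_to (R : realType) (f_ : nat -> R -> \bar R)
    (f : R -> \bar R) : Prop :=
  holds_ae (fun x => increases_to (f_ ^~ x) (f x)).

(* [s] lists the pairs (c_i, I_i) of a representation of [phi]. *)
Definition step_repr (R : realType) (s : seq (R * interval R)) (phi : R -> R)
    : Prop :=
  (forall p, p \in s -> bounded_set [set` p.2]) /\
  (forall x, phi x = \sum_(p <- s) p.1 * \1_[set` p.2] x)%R.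

Definition inR0 (R : realType) (phi : R -> R) : Prop :=
  exists s, step_repr s phi.

(* Each of the three integrals below is a value selected among those produced
   by the admissible representations (all of which give the same value); the
   default 0 is only returned outside the corresponding class. *)
Definition int0 (R : realType) (phi : R -> R) : R :=
  xget 0%R [set v | exists2 s, step_repr s phi &
    v = (\sum_(p <- s) p.1 * fine (itv_length p.2))%R].

Definition approx1 (R : realType) (phi_ : nat -> R -> R) (f : R -> \bar R)
    : Prop :=
  (forall n, inR0 (phi_ n)) /\ ae_increases_to (fun n x => (phi_ n x)%:E) f.

Definition inR1 (R : realType) (f : R -> \bar R) : Prop :=
  exists phi_, approx1 phi_ f.

Definition int1 (R : realType) (f : R -> \bar R) : \bar R :=
  xget 0 [set v | exists2 phi_, approx1 phi_ f &
    (int0 (phi_ n))%:E @[n --> \oo] --> v].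

(* A function of R_1 is > -oo a.e., and < +oo a.e. when its integral is finite.
   So f1 x - f2 x is a.e. not of the form +oo - +oo, and the value that the
   library gives to that expression is irrelevant. *)
Definition decomp2 (R : realType) (f1 f2 f : R -> \bar R) : Prop :=
  [/\ inR1 f1, inR1 f2,
      int1 f1 \is a fin_num \/ int1 f2 \is a fin_num &
      holds_ae (fun x => f x = f1 x - f2 x)].

Definition inR2 (R : realType) (f : R -> \bar R) : Prop :=
  exists f1 f2, decomp2 f1 f2 f.

Definition int2 (R : realType) (f : R -> \bar R) : \bar R :=
  xget 0 [set v | exists f1 f2, decomp2 f1 f2 f /\ v = int1 f1 - int1 f2].

(* Main.v *)
(** Everything is reduced to the Lebesgue measure [mu]. A function of R_2
  is exactly a function that agrees a.e. with a difference [p - q] of nonnegative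
  Borel functions one of which has finite integral, and its integral is then
  [\int p - \int q], which does not depend on [p] and [q].

  The delicate inclusion is that every nonnegative Borel [g] is of the form
  [a - b] with [a, b] in R_1 and [\int b < +oo]. Covering sets by open intervals
  gives [g + d = u] where [u] is a series of nonnegative step functions and
  [\int d] is as small as wanted; the same applies to the error [d], then to the
  new error, and so on. Summing the even and the odd equations separately yields
  two such series [a] and [b] with [a = g + b].

  Given [f_n = p_n - q_n] increasing to [f] with [\int q_N < +oo], the functions
  [f_n + q_N], [n >= N], are a.e. nonnegative and increasing, so the monotone
  convergence theorem applies to them and gives the representation
  [f = r - q_N] together with the convergence of the integrals. The same
  argument applied to step functions computes the integral on R_1. *)

Require Import Defs.
From HB Require Import structures.
From mathcomp Require Import all_boot all_order all_algebra.
From mathcomp Require Import all_classical all_reals all_analysis.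
From mathcomp Require Import measurable_realfun.

Import Order.TTheory GRing.Theory Num.Theory.
Import numFieldNormedType.Exports.
Local Open Scope classical_set_scope.
Local Open Scope ring_scope.
Local Open Scope ereal_scope.

Set Implicit Arguments.
Unset Strict Implicit.
Unset Printing Implicit Defensive.

Local Notation mu := lebesgue_measure.

(** * Interval lengths and null sets in terms of Lebesgue measure *)

Lemma itv_lengthE (R : realType) (i : interval R) :
  itv_length i = mu ([set` i] : set R).
Proof. by rewrite lebesgue_measure_itv. Qed.

(** Lebesgue outer measure is an infimum over covers by open intervals; the slack [e] pays for the
    infimum not being attained. *)
Lemma open_itv_cover_le (R : realType) (A : set R) (m e : R) :
  measurable A -> mu A <= m%:E -> (0 < e)%R ->
  exists a b : nat -> R, A `<=` \bigcup_k `]a k, b k[%classic /\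
    \sum_(k <oo) mu `]a k, b k[%classic <= (m + e)%:E.
Proof.
move=> mA Am e0.
have Afin : (wlength idfun)^*%mu A \is a fin_num.
  rewrite ge0_fin_numE ?outer_measure_ge0//.
  exact: le_lt_trans (ltry m).
move: (Afin); rewrite outer_measure_open_itv_cover.
move=> /lb_ereal_inf_adherent-/(_ _ e0)[_/= [F] [Fitv AF] <-].
rewrite -outer_measure_open_itv_cover => Fe.
have [ab abF] := choice Fitv.
exists (fst \o ab), (snd \o ab); split.
  by move=> x /AF[k _]; rewrite abF => Fkx; exists k.
rewrite EFinD; apply: le_trans (leeD2r _ Am); apply: le_trans (ltW Fe).
by apply: lee_nneseries => // k _; 
  rewrite abF/= lebesgue_measure_itv wlength_itv.
Qed.

Lemma null_setP (R : realType) (N : set R) : is_null_set N <-> mu.-negligible N.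
Proof.
split.
  move=> nullN; apply/negligible_outer_measure.
  apply/eqP; rewrite eq_le outer_measure_ge0 andbT.
  apply/lee_addgt0Pr => e /nullN[I [NI Ie]]; rewrite add0e.
  apply: le_trans (ltW Ie).
  have /le_trans := le_outer_measure (wlength idfun)^*%mu _ _ NI; apply.
  apply: (le_trans (outer_measure_sigma_subadditive _ _)).
  by apply: lee_nneseries => // k _; rewrite itv_lengthE.
move=> [A [mA A0 NA]] e e0.
(* Half of [e], because the total length of the cover must be strictly below [e]. *)
have [|||a [b [Aab abe]]] := @open_itv_cover_le R A 0 (e / 2).
- by [].
- by rewrite A0.
- by rewrite divr_gt0.
exists (fun k => `]a k, b k[); split; first exact: subset_trans Aab.
under eq_eseriesr do rewrite itv_lengthE.
by apply: (le_lt_trans abe);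
  rewrite add0r lte_fin ltr_pdivrMr// ltr_pMr// ltr1n.
Qed.

Lemma holds_aeP (R : realType) (P : R -> Prop) :
  holds_ae P <-> {ae mu, forall x, P x}.
Proof. exact: null_setP. Qed.

(** * Step functions and their integrals *)

Lemma itv_bounded_fin (R : realType) (i : interval R) :
  bounded_set [set` i] -> mu [set` i] \is a fin_num.
Proof.
move=> [M [_ Mi]]; rewrite ge0_fin_numE//.
have iS : [set` i] `<=` `[(- (M + 1))%R, (M + 1)%R]%classic.
  move=> x ix /=; rewrite in_itv/= -ler_norml.
  by apply: (Mi (M + 1)%R) => //; rewrite ltrDl.
apply: (@le_lt_trans _ _ (mu `[(- (M + 1))%R, (M + 1)%R]%classic)).
  by apply: le_measure; rewrite ?inE//.
by rewrite lebesgue_measure_itv/=; case: ifPn => // _; rewrite -EFinB ltry.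
Qed.

Lemma integral_step (R : realType) (s : seq (R * interval R)) (phi : R -> R) :
  step_repr s phi ->
  mu.-integrable setT (EFin \o phi) /\
  \int[mu]_x (phi x)%:E = (\sum_(p <- s) p.1 * fine (itv_length p.2))%:E.
Proof.
move=> [sbnd /funext ->].
rewrite (_ : \int[mu]__ _ =
  \int[mu]_x (EFin \o (fun x => \sum_(p <- s) p.1 * \1_[set` p.2] x)%R) x)//.
have -> : EFin \o (fun x => \sum_(p <- s) p.1 * \1_[set` p.2] x)%R =
    (fun x => \sum_(p <- s) p.1%:E * (\1_[set` p.2] x)%:E)%E.
  by apply/funext => x /=; rewrite -sumEFin.
elim: s sbnd => [|p s ih] sbnd.
  under eq_fun do rewrite big_nil.
  by rewrite big_nil integral0; split => //; exact: integrable0.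
have ibnd : mu [set` p.2] \is a fin_num.
  by apply: itv_bounded_fin; apply: sbnd; rewrite mem_head.
have int_p : mu.-integrable setT (fun x => (\1_[set` p.2] x)%:E).
  apply/integrableP; split; first exact/measurable_EFinP.
  under eq_integral do rewrite gee0_abs ?lee_fin//.
  by rewrite integral_indic// setIT -ge0_fin_numE.
have [|ints Is] := ih.
  by move=> q qs; apply: sbnd; rewrite in_cons qs orbT.
have int_cp := integrableZl measurableT p.1 int_p.
under eq_fun do rewrite big_cons.
split; first exact: integrableD.
rewrite integralD// Is integralZl// integral_indic// setIT.
by rewrite big_cons EFinD EFinM itv_lengthE fineK.
Qed.

Lemma inR0_integrable (R : realType) (phi : R -> R) :
  inR0 phi -> mu.-integrable setT (EFin \o phi).
Proof. by move=> [s /integral_step[]]. Qed.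

(** All representations of [phi] produce its Lebesgue integral, so the choice made by [xget] is
    immaterial. *)
Lemma int0E (R : realType) (phi : R -> R) :
  inR0 phi -> (int0 phi)%:E = \int[mu]_x (phi x)%:E.
Proof.
move=> [s sphi]; rewrite /int0.
case: xgetP => [v -> [s' /integral_step[_ ->] ->//]|].
by move=> /(_ (\sum_(p <- s) p.1 * fine (itv_length p.2))%R)[]; exists s.
Qed.

Lemma inR0D (R : realType) (phi psi : R -> R) :
  inR0 phi -> inR0 psi -> inR0 (phi \+ psi)%R.
Proof.
move=> [s [sbnd sphi]] [t [tbnd tpsi]]; exists (s ++ t); split => [p|x].
  by rewrite mem_cat => /orP[/sbnd|/tbnd].
by rewrite /= sphi tpsi big_cat.
Qed.

Lemma inR0_sum (R : realType) (phi_ : nat -> R -> R) n :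
  (forall k, inR0 (phi_ k)) -> inR0 (fun x => \sum_(0 <= k < n) phi_ k x)%R.
Proof.
move=> phi0; elim: n => [|n ih].
  by exists [::]; split => // x; rewrite big_geq// big_nil.
have := inR0D ih (phi0 n); congr inR0; apply/funext => x/=.
by rewrite big_nat_recr.
Qed.

Lemma inR0_indic_itv (R : realType) (c a b : R) :
  inR0 (fun x => c * \1_`]a, b[%classic x)%R.
Proof.
exists [:: (c, `]a, b[)]; split => [p|x]; last by rewrite big_seq1.
rewrite inE => /eqP ->/=.
exists (Num.max `|a| `|b|)%R; split; first exact: num_real.
move=> K; rewrite gt_max => /andP[aK bK] x /=; rewrite in_itv/= => /andP[ax xb].
rewrite ler_norml (le_trans _ (ltW ax)) ?(le_trans (ltW xb))//.
  by rewrite (le_trans (ler_norm _))// ltW.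
by rewrite lerNl (le_trans (ler_norm _))// normrN ltW.
Qed.

(* The hint of the library does not fire on predicates over [R], because the
   domain of [lebesgue_measure] is [R] under another canonical structure. *)
#[local] Instance ae_lebesgue_filter (R : realType) :
  Filter (nbhs (almost_everywhere (@lebesgue_measure R))).
Proof. exact: ae_filter_ringOfSetsType. Qed.

(** * Differences of nonnegative measurable functions *)

Definition ge0_mfun (R : realType) (p : R -> \bar R) : Prop :=
  measurable_fun setT p /\ forall x, 0 <= p x.

(* As in the definition of [inR2], the value of [+oo - +oo] is irrelevant: it
   occurs only on a null set. *)
Definition diff_repr (R : realType) (f p q : R -> \bar R) : Prop :=
  [/\ ge0_mfun p, ge0_mfun q,
      \int[mu]_x p x < +oo \/ \int[mu]_x q x < +oo &
      {ae mu, forall x, f x = p x - q x}].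

Lemma ge0_mfunD (R : realType) (p q : R -> \bar R) :
  ge0_mfun p -> ge0_mfun q -> ge0_mfun (p \+ q).
Proof.
by move=> [mp p0] [mq q0]; split => [|x];
  [exact: emeasurable_funD|exact: adde_ge0].
Qed.

Lemma integral_ge0_mfunD (R : realType) (p q : R -> \bar R) :
  ge0_mfun p -> ge0_mfun q ->
  \int[mu]_x (p x + q x) = \int[mu]_x p x + \int[mu]_x q x.
Proof. by move=> [mp p0] [mq q0]; rewrite ge0_integralD. Qed.

Lemma ge0_mfun_ae_lty (R : realType) (p : R -> \bar R) :
  ge0_mfun p -> \int[mu]_x p x < +oo -> {ae mu, forall x, p x < +oo}.
Proof.
move=> [mp p0] pfin.
have : mu.-integrable setT p.
  apply/integrableP; split => //.
  by under eq_integral do rewrite gee0_abs//.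
move=> /(integrable_ae measurableT); apply: filterS => x /(_ I).
by rewrite ge0_fin_numE.
Qed.

(** Moving the subtracted terms across reduces comparisons of differences to comparisons of
    nonnegative sums, whose integrals are additive and monotone. The two disjunctions exclude +oo -
    +oo. *)
Lemma le_subee_add (R : realType) (p q p' q' : \bar R) :
  0 <= p -> 0 <= q -> 0 <= p' -> 0 <= q' -> p < +oo \/ q < +oo ->
  p' < +oo \/ q' < +oo -> (p - q <= p' - q') = (p + q' <= p' + q).
Proof.
move: p q p' q' => [p||] [q||] [p'||] [q'||] //= _ _ _ _; rewrite ?ltxx.
all: try by case.
all: try by move=> _ [].
all: try by rewrite ?leey ?leNye.
by move=> _ _; rewrite -!EFinD !lee_fin lerBlDr addrAC lerBrDr.
Qed.

(** Used twice with [f = g], this shows that the difference of integrals does not depend on the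
    representation. The cross-addition [p + q' <= p' + q] is done once for the integrals and once
    pointwise. *)
Lemma diff_repr_le (R : realType) (f g p q p' q' : R -> \bar R) :
  diff_repr f p q -> diff_repr g p' q' -> {ae mu, forall x, f x <= g x} ->
  \int[mu]_x p x - \int[mu]_x q x <= \int[mu]_x p' x - \int[mu]_x q' x.
Proof.
move=> [p0 q0 pq fE] [p'0 q'0 p'q' gE] fg.
(* A function with finite integral is finite a.e., so the conditions on the integrals pass to almost
   every point. *)
have ae_or (r s : R -> \bar R) : ge0_mfun r -> ge0_mfun s ->
    \int[mu]_x r x < +oo \/ \int[mu]_x s x < +oo ->
    {ae mu, forall x, r x < +oo \/ s x < +oo}.
  move=> r0 s0 [/(ge0_mfun_ae_lty r0)|/(ge0_mfun_ae_lty s0)].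
    by apply: filterS => x; left.
  by apply: filterS => x; right.
rewrite le_subee_add//; [|by apply: integral_ge0 => x _; case: p0|
  by apply: integral_ge0 => x _; case: q0|
  by apply: integral_ge0 => x _; case: p'0|
  by apply: integral_ge0 => x _; case: q'0].
rewrite -!integral_ge0_mfunD//.
have [m1 n1] := ge0_mfunD p0 q'0.
have [m2 n2] := ge0_mfunD p'0 q0.
apply: ae_ge0_le_integral => //.
move: fE gE fg (ae_or _ _ p0 q0 pq) (ae_or _ _ p'0 q'0 p'q').
move=> fE gE fg ae_pq ae_p'q'; near=> x => _.
case: p0 q0 p'0 q'0 => [_ p0] [_ q0] [_ p'0] [_ q'0].
rewrite -le_subee_add//; [|by near: x..].
have -> : p x - q x = f x by apply/esym; near: x.
have -> : p' x - q' x = g x by apply/esym; near: x.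
by near: x.
Unshelve. all: by end_near. Qed.

Lemma diff_repr_eq (R : realType) (f p q p' q' : R -> \bar R) :
  diff_repr f p q -> diff_repr f p' q' ->
  \int[mu]_x p x - \int[mu]_x q x = \int[mu]_x p' x - \int[mu]_x q' x.
Proof.
move=> pq p'q'; apply/eqP; rewrite eq_le.
by rewrite (diff_repr_le pq p'q' (aeW _ (fun=> lexx _)))
  (diff_repr_le p'q' pq (aeW _ (fun=> lexx _))).
Qed.

Lemma diff_repr_cvg (R : realType) (f_ : nat -> R -> \bar R) (f : R -> \bar R)
    (p q : nat -> R -> \bar R) :
  (forall n, diff_repr (f_ n) (p n) (q n)) -> \int[mu]_x q 0%N x < +oo ->
  ae_increases_to f_ f ->
  exists2 r, diff_repr f r (q 0%N) &
    \int[mu]_x p n x - \int[mu]_x q n x @[n --> \oo] -->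
      \int[mu]_x r x - \int[mu]_x q 0%N x.
Proof.
move=> fpq q0fin /holds_aeP ftof.
have q0 n : ge0_mfun (q n) by case: (fpq n).
have p0 n : ge0_mfun (p n) by case: (fpq n).
have fE : {ae mu, forall x, forall n, f_ n x = p n x - q n x}.
  by apply: ae_foralln => n; case: (fpq n).
have q0x := ge0_mfun_ae_lty (q0 0%N) q0fin.
have [N [mN N0 NP]] : {ae mu, forall x, [/\ increases_to (f_ ^~ x) (f x),
    (forall n, f_ n x = p n x - q n x) & q 0%N x < +oo]}.
  by apply: filterS3 ftof fE q0x.
have {}NP x : x \in ~` N -> [/\ increases_to (f_ ^~ x) (f x),
    (forall n, f_ n x = p n x - q n x) & q 0%N x < +oo].
  by rewrite inE => Nx; apply: contrapT => /NP.
have mNC : measurable (~` N) by exact: measurableC.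
(* This is [f_ n + q 0] off the null set [N] and 0 on it, so that monotonicity and nonnegativity
   hold at every point. *)
pose g n := (fun x => p n x - q n x + q 0%N x) \_ (~` N).
have gin n x : x \in ~` N -> g n x = f_ n x + q 0%N x.
  by move=> Nx; rewrite /g patchE Nx; have [_ -> _] := NP _ Nx.
have gout n x : x \in ~` N = false -> g n x = 0.
  by move=> Nx; rewrite /g patchE Nx.
have g_nd x : nondecreasing_seq (g ^~ x).
  apply/nondecreasing_seqP => n.
  have [Nx|/negbTE Nx] := boolP (x \in ~` N); last by rewrite !gout.
  by rewrite !gin// leeD2r//; have [[]] := NP _ Nx.
have g0 n : ge0_mfun (g n).
  split.
    apply/(measurable_restrictT _ _).1 => //; apply: measurable_funTS.
    apply: emeasurable_funD; last by case: (q0 0%N).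
    by apply: emeasurable_funB; [case: (p0 n)|case: (q0 n)].
  (* By monotonicity only [g 0] has to be nonnegative, and off [N] it equals [p 0]. *)
  move=> x; apply: le_trans (g_nd x 0%N n (leq0n _)).
  have [Nx|/negbTE Nx] := boolP (x \in ~` N); last by rewrite gout.
  rewrite gin//; have [_ -> q0oo] := NP _ Nx.
  by rewrite subeK ?ge0_fin_numE//; [case: (p0 0%N)|case: (q0 0%N)].
have gcvg x : cvgn (g ^~ x) by exact: ereal_nondecreasing_is_cvgn.
pose r x := limn (g ^~ x).
have r0 : ge0_mfun r.
  split; last first.
    by move=> x; apply: lime_ge => //; apply: nearW => n; case: (g0 n).
  by apply: (emeasurable_fun_cvg g) => [n|x _]; [case: (g0 n)|exact: gcvg].
have aeN (P : R -> Prop) :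
    (forall x, x \in ~` N -> P x) -> {ae mu, forall x, P x}.
  move=> NNP; exists N; split => // x/= nPx; apply: contrapT => Nx.
  by apply: nPx; apply: NNP; rewrite inE.
(* All the [f_ n] now share the subtracted function [q 0], and only the integrals of [g n] vary with
   [n]. *)
have gq n : diff_repr (f_ n) (g n) (q 0%N).
  split => //; [by right|apply: aeN => x Nx].
  rewrite gin// addeK// ge0_fin_numE; first by have [] := NP _ Nx.
  by case: (q0 0%N).
have rq : diff_repr f r (q 0%N).
  split => //; [by right|apply: aeN => x Nx].
  have [[_ fx] _ q0oo] := NP _ Nx.
  have q0x_fin : q 0%N x \is a fin_num.
    by rewrite ge0_fin_numE//; case: (q0 0%N).
  rewrite /r (_ : g ^~ x = fun n => f_ n x + q 0%N x); last first.
    by apply/funext => n; rewrite gin.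
  rewrite (_ : limn _ = f x + q 0%N x) ?addeK//.
  by apply/cvg_lim => //; apply: cvgeD => //;
    [exact: fin_num_adde_defl|exact: cvg_cst].
exists r => //.
under eq_fun do rewrite (diff_repr_eq (fpq _) (gq _)).
have q0int : \int[mu]_x q 0%N x \is a fin_num.
  by rewrite ge0_fin_numE//; apply: integral_ge0 => x _; case: (q0 0%N).
apply: cvgeB; [by rewrite fin_num_adde_defl// fin_numN| |exact: cvg_cst].
apply: cvg_monotone_convergence => //.
- by move=> n; case: (g0 n).
- by move=> n x _; case: (g0 n).
Qed.

(** * The classes R_0 and R_1 as differences *)

Lemma inR0_diff_repr (R : realType) (phi : R -> R) : inR0 phi ->
  exists p q, [/\ diff_repr (EFin \o phi) p q, \int[mu]_x q x < +oo &
    (int0 phi)%:E = \int[mu]_x p x - \int[mu]_x q x].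
Proof.
move=> phi0; have iphi := inR0_integrable phi0.
have mphi : measurable_fun setT (EFin \o phi) by case/integrableP: iphi.
have nfin := integrable_neg_fin_num measurableT iphi.
exists (EFin \o phi)^\+, (EFin \o phi)^\-; split; last 2 first.
- by rewrite ltey_eq nfin.
- by rewrite int0E// integralE.
split.
- by split => //; exact: measurable_funepos.
- by split => //; exact: measurable_funeneg.
- by right; rewrite ltey_eq nfin.
- by apply: aeW => x; rewrite {1}(funeposneg (EFin \o phi)).
Qed.

Lemma approx1_diff_repr (R : realType) (phi_ : nat -> R -> R)
    (f : R -> \bar R) :
  approx1 phi_ f ->
  exists p q, [/\ diff_repr f p q, \int[mu]_x q x < +oo &
    (int0 (phi_ n))%:E @[n --> \oo] --> \int[mu]_x p x - \int[mu]_x q x].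
Proof.
move=> [phi0 phif].
have [p /choice[q pq]] := choice (fun n => inR0_diff_repr (phi0 n)).
have [||r rq rcvg] := @diff_repr_cvg R _ f p q _ _ phif.
- by move=> n; have [] := pq n.
- by have [] := pq 0%N.
exists r, (q 0%N); split => //; first by have [] := pq 0%N.
apply: cvg_trans rcvg; apply: near_eq_cvg; apply: nearW => n.
by have [] := pq n.
Qed.

(** Every approximating sequence has integrals tending to the difference attached to some
    representation of [f]; by [diff_repr_eq] these limits agree, so [int1] is well defined. *)
Lemma inR1_diff_repr (R : realType) (f : R -> \bar R) : inR1 f ->
  exists p q, [/\ diff_repr f p q, \int[mu]_x q x < +oo &
    int1 f = \int[mu]_x p x - \int[mu]_x q x].
Proof.
move=> [phi_ phif]; have [p [q [fpq qfin phicvg]]] := approx1_diff_repr phif.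
exists p, q; split => //; rewrite /int1.
case: xgetP => [v -> [psi_ psif psicvg]|
  /(_ (\int[mu]_x p x - \int[mu]_x q x))[]].
  have [p' [q' [fp'q' _ psicvg']]] := approx1_diff_repr psif.
  by rewrite (diff_repr_eq fpq fp'q'); apply: cvg_unique psicvg psicvg'.
by exists phi_.
Qed.

(** * Series of nonnegative step functions *)

(** The sum is prescribed at every point, not just a.e., so that later decompositions are equalities
    of functions. *)
Definition step_series (R : realType) (u : R -> \bar R) : Prop :=
  exists phi_ : nat -> R -> R, [/\ forall n, inR0 (phi_ n),
    forall n x, (0 <= phi_ n x)%R & forall x, u x = \sum_(n <oo) (phi_ n x)%:E].

Lemma step_series_ge0_mfun (R : realType) (u : R -> \bar R) :
  step_series u -> ge0_mfun u.
Proof.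
move=> [phi_ [phiR0 phi0 /funext ->]]; split => [|x].
  apply: ge0_emeasurable_sum => [n x _ _|n _]; first by rewrite lee_fin.
  by have /integrableP[] := inR0_integrable (phiR0 n).
by apply: nneseries_ge0 => n _ _; rewrite lee_fin.
Qed.

Lemma ge0_mfun_diff_repr (R : realType) (u : R -> \bar R) :
  ge0_mfun u -> diff_repr u u (cst 0).
Proof.
move=> u0; split => //.
- by right; rewrite integral0.
- by apply: aeW => x; rewrite sube0.
Qed.

Lemma step_series_inR1 (R : realType) (u : R -> \bar R) :
  step_series u -> inR1 u.
Proof.
move=> [phi_ [phiR0 phi0 uE]].
exists (fun n x => \sum_(0 <= k < n) phi_ k x)%R; split.
  by move=> n; exact: inR0_sum.
apply/holds_aeP; apply: aeW => x; split.
  by move=> n; rewrite lee_fin big_nat_recr//= lerDl.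
rewrite uE; under eq_fun do rewrite -sumEFin.
by apply: is_cvg_nneseries => n _ _; rewrite lee_fin.
Qed.

Lemma int1_step_series (R : realType) (u : R -> \bar R) :
  step_series u -> int1 u = \int[mu]_x u x.
Proof.
move=> su; have [p [q [upq _ ->]]] := inR1_diff_repr (step_series_inR1 su).
have uu := ge0_mfun_diff_repr (step_series_ge0_mfun su).
by rewrite (diff_repr_eq upq uu) integral0 sube0.
Qed.

Lemma step_series_nneseries (R : realType) (u : nat -> R -> \bar R) :
  (forall k, step_series (u k)) -> step_series (fun x => \sum_(k <oo) u k x).
Proof.
move=> /choice[phi_ uphi].
have /card_set_bijP[e ebij] : ([set: nat] #= [set: nat * nat])%card.
  by rewrite card_eq_sym; exact: card_nat2.
exists (fun n => phi_ (e n).1 (e n).2); split.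
- by move=> n; have [] := uphi (e n).1.
- by move=> n; have [] := uphi (e n).1.
move=> x; have phi0 k n : (0 <= (phi_ k n x)%:E).
  by rewrite lee_fin; have [] := uphi k.
(* Nonnegative series are unordered sums, which may be reindexed along [e] and summed
   iteratively. *)
rewrite (nneseries_esumT (fun n => phi0 (e n).1 (e n).2)).
rewrite -(@reindex_esum R _ _ _ _ e (fun kn => (phi_ kn.1 kn.2 x)%:E) ebij).
rewrite (_ : [set: nat * nat] = [set: nat] `*`` (fun=> [set: nat])); last first.
  by apply/seteqP; split.
rewrite -(@esum_esum R _ _ setT (fun=> setT) (fun k n => (phi_ k n x)%:E))//.
rewrite nneseries_esumT => [|k].
  apply: eq_esum => k _; have [_ _ ->] := uphi k.
  by rewrite nneseries_esumT.
by have [_ _ ->] := uphi k; exact: nneseries_ge0.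
Qed.

Lemma step_series0 (R : realType) : step_series (cst (0 : \bar R)).
Proof.
exists (fun _ _ => 0%R); split => // [_|x]; last by rewrite eseries0.
by exists [::]; split => // x; rewrite big_nil.
Qed.

(** Padding a pair to a sequence derives closure under binary sums from closure under series. *)
Definition pair_seq (T : Type) (x y z : T) (k : nat) : T :=
  match k with 0%N => x | 1%N => y | _ => z end.

Lemma nneseries_pair_seq (R : realType) (x y : \bar R) : 0 <= x -> 0 <= y ->
  \sum_(k <oo) pair_seq x y 0 k = x + y.
Proof.
move=> x0 y0; rewrite (nneseries_split 0 2); last by move=> [|[|]].
rewrite eseries0 ?adde0; last by move=> [|[|]].
by rewrite add0n 2?big_nat_recl// big_geq// adde0.
Qed.

Lemma step_seriesD (R : realType) (u v : R -> \bar R) :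
  step_series u -> step_series v -> step_series (u \+ v).
Proof.
move=> su sv.
have -> : u \+ v = fun x => \sum_(k <oo) pair_seq u v (cst 0) k x.
  apply/funext => x /=; rewrite -nneseries_pair_seq; last 2 first.
  - by case: (step_series_ge0_mfun su).
  - by case: (step_series_ge0_mfun sv).
  by apply: eq_eseriesr => -[|[|]].
by apply: step_series_nneseries => -[|[|k]]//; exact: step_series0.
Qed.

Lemma ge0_mfun_nneseries (R : realType) (u : nat -> R -> \bar R) :
  (forall k, ge0_mfun (u k)) -> ge0_mfun (fun x => \sum_(k <oo) u k x).
Proof.
move=> u0; split => [|x]; last by apply: nneseries_ge0 => n _ _; case: (u0 n).
by apply: ge0_emeasurable_sum => [n x _ _|n _]; case: (u0 n).
Qed.

Lemma integral_ge0_mfun_nneseries (R : realType) (u : nat -> R -> \bar R) :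
  (forall k, ge0_mfun (u k)) ->
  \int[mu]_x (\sum_(k <oo) u k x) = \sum_(k <oo) \int[mu]_x u k x.
Proof.
by move=> u0; rewrite integral_nneseries// => n; case: (u0 n).
Qed.

(** * Approximation from above by step series *)

(** The error [d] is kept as a function, to be approximated in its turn; writing [u = g \+ d] avoids
    a subtraction of infinite values. *)
Definition step_approx (R : realType) (g : R -> \bar R) : Prop :=
  forall e : R, (0 < e)%R -> exists u d : R -> \bar R,
    [/\ step_series u, ge0_mfun d, \int[mu]_x d x <= e%:E & u = g \+ d].

Lemma step_approx_nneseries (R : realType) (g : nat -> R -> \bar R) :
  (forall k x, 0 <= g k x) -> (forall k, step_approx (g k)) ->
  step_approx (fun x => \sum_(k <oo) g k x).
Proof.
move=> g0 gapp e e0.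
(* The tolerances for the terms add up to [e]. *)
have ek k : (0 < e / (2 ^ k.+1)%:R)%R by rewrite divr_gt0// ltr0n expn_gt0.
have [u /choice[d ud]] := choice (fun k => gapp k _ (ek k)).
exists (fun x => \sum_(k <oo) u k x), (fun x => \sum_(k <oo) d k x); split.
- by apply: step_series_nneseries => k; have [] := ud k.
- by apply: ge0_mfun_nneseries => k; have [] := ud k.
- rewrite integral_ge0_mfun_nneseries; last by move=> k; have [] := ud k.
  apply: le_trans (epsilon_trick0 xpredT (ltW e0)).
  apply: lee_nneseries => k _; last by have [] := ud k.
  by move=> _; apply: integral_ge0 => x _; have [_ []] := ud k.
- apply/funext => x /=; rewrite -nneseriesD//; last first.
    by move=> k _ _; have [_ []] := ud k.
  by apply: eq_eseriesr => k _; have [_ _ _ ->] := ud k.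
Qed.

Lemma step_approx0 (R : realType) : step_approx (cst (0 : \bar R)).
Proof.
move=> e e0; exists (cst 0), (cst 0); split => //.
- exact: step_series0.
- by rewrite integral0 lee_fin ltW.
- by apply/funext => x /=; rewrite adde0.
Qed.

Lemma step_approxD (R : realType) (f g : R -> \bar R) :
  (forall x, 0 <= f x) -> (forall x, 0 <= g x) ->
  step_approx f -> step_approx g -> step_approx (f \+ g).
Proof.
move=> f0 g0 fapp gapp.
have -> : f \+ g = fun x => \sum_(k <oo) pair_seq f g (cst 0) k x.
  apply/funext => x /=; rewrite -nneseries_pair_seq//.
  by apply: eq_eseriesr => -[|[|]].
apply: step_approx_nneseries => -[|[|k]]//; exact: step_approx0.
Qed.

Lemma step_approx_sum (R : realType) n (f : 'I_n -> R -> \bar R) :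
  (forall i x, 0 <= f i x) -> (forall i, step_approx (f i)) ->
  step_approx (fun x => \sum_(i < n) f i x).
Proof.
elim: n f => [|n ih] f f0 fapp.
  by under eq_fun do rewrite big_ord0; exact: step_approx0.
under eq_fun do rewrite big_ord_recr.
apply: step_approxD => //; last exact: ih.
by move=> x; exact: sume_ge0.
Qed.

Lemma step_approx_indic_fin (R : realType) (c : R) (A : set R) :
  (0 <= c)%R -> measurable A -> mu A < +oo ->
  step_approx (fun x => (c * \1_A x)%:E).
Proof.
move=> c0 mA Afin e e0.
have muAE : mu A = (fine (mu A))%:E by rewrite fineK// ge0_fin_numE.
(* The denominator [c + 1] is positive even for [c = 0], and [c * (e / (c + 1)) <= e]. *)
have [||a [b [Aab abe]]] :=
    @open_itv_cover_le R A (fine (mu A)) (e / (c + 1)) mA.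
- by rewrite -muAE.
- by rewrite divr_gt0// ltr_wpDl.
(* [h] counts the intervals containing [x]; it dominates the indicator of [A], which they cover. *)
pose h x : \bar R := \sum_(k <oo) (\1_`]a k, b k[%classic x)%:E.
have h0 : ge0_mfun h.
  apply: ge0_mfun_nneseries => k; split => [|x]; last by rewrite lee_fin.
  exact/measurable_EFinP.
have Ah x : (\1_A x)%:E <= h x.
  rewrite indicE; case: (boolP (x \in A)) => [|_]; last by case: h0.
  rewrite inE => /Aab[k _ abkx]; rewrite /h (@nneseriesD1 _ _ k)//.
  rewrite (_ : \1_`]a k, b k[%classic x = 1%R) ?leeDl//; last first.
    by rewrite indicE mem_set.
  by apply: nneseries_ge0 => n _ _; rewrite lee_fin.
pose d x := h x - (\1_A x)%:E.
have d0 : ge0_mfun d.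
  split => [|x]; last by rewrite /d sube_ge0.
  apply: emeasurable_funB; first by case: h0.
  exact/measurable_EFinP.
have hE x : h x = (\1_A x)%:E + d x by rewrite /d addeC subeK.
have intd : \int[mu]_x d x <= (e / (c + 1))%:E.
  (* As [mu A] is finite, it can be added to both sides; the left side then becomes the integral of
     [h], the total length of the cover. *)
  rewrite -(@leeD2lE _ (mu A)); last by rewrite ge0_fin_numE.
  rewrite [in leRHS]muAE -EFinD; apply: le_trans abe.
  have {1}-> : mu A = \int[mu]_x (\1_A x)%:E by rewrite integral_indic// setIT.
  rewrite -ge0_integralD//.
  - under eq_integral do rewrite -hE.
    rewrite integral_nneseries//; last by move=> k; exact/measurable_EFinP.
    by apply: lee_nneseries => // k _; rewrite integral_indic// setIT.
  - exact/measurable_EFinP.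
  - by move=> x _; case: d0.
  - by case: d0.
exists (fun x => c%:E * h x), (fun x => c%:E * d x); split.
- exists (fun k x => c * \1_`]a k, b k[%classic x)%R; split.
  + by move=> k; exact: inR0_indic_itv.
  + by move=> k x; rewrite mulr_ge0.
  + by move=> x; rewrite -nneseriesZl.
- split => [|x]; last by rewrite mule_ge0//; case: d0.
  by apply: emeasurable_funM => //; case: d0.
- case: d0 => md d0; rewrite ge0_integralZl_EFin//.
  apply: (@le_trans _ _ (c%:E * (e / (c + 1))%:E)).
    by apply: lee_pmul => //; exact: integral_ge0.
  rewrite -EFinM lee_fin mulrCA; apply: ler_piMr; first exact: ltW.
  by rewrite ler_pdivrMr ?mul1r ?lerDl// ltr_wpDl.
- by apply/funext => x /=; rewrite hE EFinM ge0_muleDr// ?lee_fin//; case: d0.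
Qed.

(** By sigma-finiteness [A] is a disjoint union of pieces of finite measure, and its indicator is
    the series of theirs. *)
Lemma step_approx_indic (R : realType) (c : R) (A : set R) :
  (0 <= c)%R -> measurable A -> step_approx (fun x => (c * \1_A x)%:E).
Proof.
move=> c0 mA.
have [F FT /all_and2[mF Ffin]] := sigma_finiteT (@lebesgue_measure R).
have AE : A = \bigcup_k (A `&` seqDU F k).
  by rewrite -setI_bigcupr -seqDU_bigcup_eq -FT setIT.
have tF : trivIset setT (fun k => A `&` seqDU F k).
  by apply: trivIset_setIl; exact: trivIset_seqDU.
have mFk k : measurable (A `&` seqDU F k).
  by apply: measurableI => //; exact: seqDU_measurable.
have -> : (fun x => (c * \1_A x)%:E) =
    fun x => \sum_(k <oo) (c * \1_(A `&` seqDU F k) x)%:E.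
  apply/funext => x; rewrite EFinM [in LHS]AE indic_bigcup// -nneseriesZl//.
apply: step_approx_nneseries => [k x|k]; first by rewrite lee_fin mulr_ge0.
apply: step_approx_indic_fin => //; apply: le_lt_trans (Ffin k).
apply: le_measure; rewrite ?inE; [exact: mFk|exact: mF|].
by move=> x [_]; exact: subset_seqDU.
Qed.

Lemma step_approx_fimfun (R : realType) (h : {fimfun R >-> R}) :
  measurable_fun setT h -> (forall x, 0 <= h x)%R -> step_approx (EFin \o h).
Proof.
move=> mh h0; pose s : seq R := finmap.enum_fset (fset_set (range h)).
have -> : EFin \o h =
    fun x => \sum_(i < size s) ((s`_i)%R * \1_(h @^-1` [set (s`_i)%R]) x)%:E.
  by apply/funext => x /=; rewrite fimfunEord sumEFin.
have s0 (i : 'I_(size s)) : (0 <= s`_i)%R.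
  have : (s`_i)%R \in s by rewrite mem_nth.
  by rewrite /s in_fset_set// inE => -[x _ <-].
apply: step_approx_sum => [i x|i]; first by rewrite lee_fin mulr_ge0.
apply: step_approx_indic => //.
by rewrite -[_ @^-1` _]setTI; exact: mh.
Qed.

Import HBNNSimple.

(** An increasing sequence of simple functions tending to [g] writes it as its first term plus the
    series of its increments, all nonnegative and simple. *)
Lemma step_approx_ge0_mfun (R : realType) (g : R -> \bar R) :
  ge0_mfun g -> step_approx g.
Proof.
move=> [mg g0].
pose s := nnsfun_approx measurableT mg.
have s_nd x : {homo (fun n => s n x) : m n / (m <= n)%N >-> (m <= n)%R}.
  by move=> m n mn; have /lefP := nd_nnsfun_approx measurableT mg mn; exact.
have -> : g = (EFin \o s 0%N) \+
    (fun x => \sum_(n <oo) (s n.+1 x - s n x)%:E).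
  apply/funext => x /=.
  have -> : \sum_(n <oo) (s n.+1 x - s n x)%:E = g x - (s 0%N x)%:E.
    apply/cvg_lim => //; under eq_fun do rewrite sumEFin telescope_sumr//.
    under eq_fun do rewrite EFinB.
    apply: cvgeB; [exact: fin_num_adde_defl| |exact: cvg_cst].
    exact: (cvg_nnsfun_approx measurableT mg (fun x _ => g0 x) I).
  by rewrite addeC subeK.
apply: step_approxD => [x|x| |].
- by rewrite lee_fin.
- by apply: nneseries_ge0 => n _ _; rewrite lee_fin subr_ge0 s_nd.
- by apply: step_approx_fimfun.
apply: step_approx_nneseries => [n x|n].
  by rewrite lee_fin subr_ge0 s_nd.
apply: (@step_approx_fimfun _
  ((s n.+1 : {fimfun R >-> R}) - (s n : {fimfun R >-> R}))%R).
  by apply: measurable_funB.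
by move=> x /=; rewrite subr_ge0 s_nd.
Qed.

(** * Nonnegative functions as differences of step series *)

Lemma nneseriesS (R : realType) (f : nat -> \bar R) : (forall n, 0 <= f n) ->
  \sum_(n <oo) f n = f 0%N + \sum_(n <oo) f n.+1.
Proof.
move=> f0; rewrite nneseries_recl// -(nneseries_addn 1)//.
by under [in RHS]eq_eseriesr do rewrite -addn1.
Qed.

(* Starting from [h 0 = g], one chooses [h k + d k = u k] and
   [d k + h k.+1 = v k] with summable errors; then [a = \sum u k] and
   [b = \sum v k]. *)
Lemma ge0_mfun_step_series_diff (R : realType) (g : R -> \bar R) : ge0_mfun g ->
  exists a b, [/\ step_series a, step_series b, \int[mu]_x b x < +oo &
    a = g \+ b].
Proof.
move=> g0; pose T := {h : R -> \bar R | ge0_mfun h}.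
pose e k : R := (1 / (2 ^ k.+1)%:R)%R.
have e0 k : (0 < e k)%R by rewrite divr_gt0// ltr0n expn_gt0.
have step (kh : nat * T) : exists h' : T, exists u v d, [/\ step_series u,
    step_series v, ge0_mfun d, \int[mu]_x d x <= (e kh.1)%:E &
    [/\ \int[mu]_x sval h' x <= (e kh.1)%:E,
        u = sval kh.2 \+ d & v = d \+ sval h']].
  case: kh => k [h h0] /=.
  have [u [d [su d0 de uE]]] := step_approx_ge0_mfun h0 (e0 k).
  have [v [h' [sv h'0 h'e vE]]] := step_approx_ge0_mfun d0 (e0 k).
  by exists (exist _ h' h'0), u, v, d; split.
have [nxt nxtP] := choice step.
(* The index is passed to [nxt] because the tolerance [e k] changes at each stage; the type [T]
   carries [ge0_mfun] through the recursion. *)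
pose h := fix h k := if k is k'.+1 then nxt (k', h k') else exist _ g g0 : T.
have [u /choice[v /choice[d uvd]]] := choice (fun k => nxtP (k, h k)).
have h0 k x : 0 <= sval (h k) x by case: (svalP (h k)).
have d0 k x : 0 <= d k x by have [_ _ []] := uvd k.
have sumdh x :
    \sum_(k <oo) v k x = \sum_(k <oo) d k x + \sum_(k <oo) sval (h k.+1) x.
  rewrite -nneseriesD//; apply: eq_eseriesr => k _.
  by have [_ _ _ _ [_ _ ->]] := uvd k.
exists (fun x => \sum_(k <oo) u k x), (fun x => \sum_(k <oo) v k x); split.
- by apply: step_series_nneseries => k; have [] := uvd k.
- by apply: step_series_nneseries => k; have [] := uvd k.
- under eq_integral do rewrite sumdh.
  have dm : ge0_mfun (fun x => \sum_(k <oo) d k x).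
    by apply: ge0_mfun_nneseries => k; have [] := uvd k.
  have hm : ge0_mfun (fun x => \sum_(k <oo) sval (h k.+1) x).
    by apply: ge0_mfun_nneseries => k; exact: svalP.
  rewrite integral_ge0_mfunD//.
  rewrite !integral_ge0_mfun_nneseries; last 2 first.
  + by move=> k; exact: svalP.
  + by move=> k; have [] := uvd k.
  (* The errors [d k] and [h k.+1] have integrals at most [e k], and the [e k] sum to 1. *)
  apply: (@le_lt_trans _ _ (1%:E + 1%:E)); last by rewrite -EFinD ltry.
  apply: leeD; apply: le_trans (epsilon_trick0 xpredT ler01).
    apply: lee_nneseries => k _; last by have [] := uvd k.
    by move=> _; exact: integral_ge0.
  apply: lee_nneseries => k _; last by have [_ _ _ _ []] := uvd k.
  by move=> _; exact: integral_ge0.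
- apply/funext => x /=.
  (* Since [h 0] is [g], adding [g] to the series of the [h k.+1] restores the full series of the
     [h k], which pairs with the [d k] to give the [u k]. *)
  rewrite sumdh addeCA -(nneseriesS (f := fun k => sval (h k) x))//.
  rewrite addeC -nneseriesD//; apply: eq_eseriesr => k _.
  by have [_ _ _ _ [_ -> _]] := uvd k.
Qed.

(** * The class R_2 and its integral *)

(** For [p = p' = +oo] both sides reduce to the same conventional value of +oo - +oo. *)
Lemma subeeB (R : realType) (p q p' q' : \bar R) :
  0 <= p -> 0 <= p' -> q \is a fin_num -> q' \is a fin_num ->
  p - q - (p' - q') = (p + q') - (q + p').
Proof.
move: p q p' q' => [p||] [q||] [p'||] [q'||] //= _ _ _ _.
by rewrite -!EFinD; congr EFin; rewrite opprB opprD addrACA.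
Qed.

Lemma integral_ge0_mfun_ge0 (R : realType) (p : R -> \bar R) :
  ge0_mfun p -> 0 <= \int[mu]_x p x.
Proof. by move=> [_ p0]; exact: integral_ge0. Qed.

Lemma integral_ge0_mfun_fin_num (R : realType) (p : R -> \bar R) :
  ge0_mfun p -> (\int[mu]_x p x \is a fin_num) = (\int[mu]_x p x < +oo).
Proof. by move=> /integral_ge0_mfun_ge0; exact: ge0_fin_numE. Qed.

Lemma decomp2_diff_repr (R : realType) (f1 f2 f : R -> \bar R) :
  decomp2 f1 f2 f -> exists p q, diff_repr f p q /\
    int1 f1 - int1 f2 = \int[mu]_x p x - \int[mu]_x q x.
Proof.
move=> [/inR1_diff_repr[p1 [q1 [[p10 q10 _ f1E] q1fin int1E]]]].
move=> /inR1_diff_repr[p2 [q2 [[p20 q20 _ f2E] q2fin int2E]]].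
move=> f12fin /holds_aeP fE.
exists (p1 \+ q2), (q1 \+ p2).
have intE : int1 f1 - int1 f2 =
    \int[mu]_x (p1 \+ q2) x - \int[mu]_x (q1 \+ p2) x.
  rewrite int1E int2E /= !integral_ge0_mfunD//.
  rewrite subeeB//; try exact: integral_ge0_mfun_ge0.
    by rewrite integral_ge0_mfun_fin_num.
  by rewrite integral_ge0_mfun_fin_num.
split => //; split; [exact: ge0_mfunD|exact: ge0_mfunD| |].
  rewrite /= !integral_ge0_mfunD//.
  (* With [q1] and [q2] of finite integral, finiteness of [int1 f1] or [int1 f2] yields that of the
     integral of [p1] or [p2]. *)
  move: f12fin; rewrite int1E int2E.
  rewrite (fin_numB (\int[mu]_x p1 x)) (fin_numB (\int[mu]_x p2 x)).
  rewrite !integral_ge0_mfun_fin_num// => -[] /andP[pfin _].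
    by left; exact: lte_add_pinfty.
  by right; exact: lte_add_pinfty.
have q1x := ge0_mfun_ae_lty q10 q1fin.
have q2x := ge0_mfun_ae_lty q20 q2fin.
near=> x.
rewrite -subeeB; [|by case: p10|by case: p20|
  by rewrite ge0_fin_numE; [near: x|case: q10]|
  by rewrite ge0_fin_numE; [near: x|case: q20]].
have <- : f1 x = p1 x - q1 x by near: x.
have <- : f2 x = p2 x - q2 x by near: x.
by near: x.
Unshelve. all: by end_near. Qed.

(** Writing [p = a - b] and [q = a' - b'] gives [f = (a + b') - (a' + b)] a.e., a difference of step
    series. *)
Lemma diff_repr_inR2 (R : realType) (f p q : R -> \bar R) :
  diff_repr f p q -> inR2 f.
Proof.
move=> [p0 q0 pqfin fE].
have [a [b [sa sb bfin aE]]] := ge0_mfun_step_series_diff p0.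
have [a' [b' [sa' sb' b'fin a'E]]] := ge0_mfun_step_series_diff q0.
have b0 := step_series_ge0_mfun sb.
have b'0 := step_series_ge0_mfun sb'.
have s1 := step_seriesD sa sb'.
have s2 := step_seriesD sa' sb.
exists (a \+ b'), (a' \+ b); split; [exact: step_series_inR1..| |].
  rewrite !int1_step_series// !integral_ge0_mfun_fin_num;
    [|exact: step_series_ge0_mfun..].
  (* The two integrals are those of [p] and [q], each increased by the finite integrals of [b] and
     [b']. *)
  rewrite aE a'E !integral_ge0_mfunD//; try exact: ge0_mfunD.
  by case: pqfin => pqfin; [left|right]; do 2 apply: lte_add_pinfty => //.
apply/holds_aeP.
have bx := ge0_mfun_ae_lty b0 bfin.
have b'x := ge0_mfun_ae_lty b'0 b'fin.
near=> x.
have -> : f x = p x - q x by near: x.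
rewrite aE a'E /=.
have : b x \is a fin_num by rewrite ge0_fin_numE; [near: x|case: b0].
have : b' x \is a fin_num by rewrite ge0_fin_numE; [near: x|case: b'0].
case: p0 q0 => _ /(_ x) + [_ /(_ x)].
move: (p x) (q x) (b x) (b' x) => [r||] [s||] [t||] [t'||] //= _ _ _ _.
by rewrite -!EFinD -(addrA r) -(addrA s) (addrC t' t) (addrC s) addrKA.
Unshelve. all: by end_near. Qed.

Lemma int2_diff_repr (R : realType) (f p q : R -> \bar R) :
  diff_repr f p q -> int2 f = \int[mu]_x p x - \int[mu]_x q x.
Proof.
move=> fpq; have [f1 [f2 f12]] := diff_repr_inR2 fpq; rewrite /int2.
case: xgetP => [v -> [g1 [g2 [/decomp2_diff_repr[p' [q' [fp'q' ->]]] ->]]]|].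
  exact: diff_repr_eq fp'q' fpq.
by move=> /(_ (int1 f1 - int1 f2))[]; exists f1, f2.
Qed.

Theorem theorem4p2 (R : realType) (f_ : nat -> R -> \bar R) (f : R -> \bar R)
    (f_R2 : forall n, inR2 (f_ n))
    (f_cvg : ae_increases_to f_ f)
    (f_int : exists n, -oo < int2 (f_ n)) :
  inR2 f /\ increases_to (fun n => int2 (f_ n)) (int2 f).
Proof.
have f_repr n : exists p q, diff_repr (f_ n) p q.
  have [f1 [f2 /decomp2_diff_repr[p [q [fpq _]]]]] := f_R2 n.
  by exists p, q.
have [p /choice[q fpq]] := choice f_repr.
have [N fN] := f_int.
(* An infinite integral of [q N] would make that of [f_ N] equal to -oo. *)
have qNfin : \int[mu]_x q N x < +oo.
  move: fN; rewrite (int2_diff_repr (fpq N)) !ltNge; apply: contra.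
  rewrite leye_eq => /eqP qNoo.
  have [_ _ [pfin|]] := fpq N; last by rewrite qNoo.
  by rewrite qNoo addeNy.
(* Dropping the first [N] terms puts [q N] at index 0, where [diff_repr_cvg] needs the finite
   integral. *)
have fN_cvg : ae_increases_to (fun n => f_ (n + N)%N) f.
  move/holds_aeP : f_cvg => f_cvg; apply/holds_aeP.
  apply: filterS f_cvg => x [f_nd f_x]; split => [n|]; first exact: f_nd.
  by rewrite (cvg_shiftn N (f_ ^~ x)).
have [r frq int_cvg] := diff_repr_cvg (fun n => fpq (n + N)%N) qNfin fN_cvg.
split; first exact: diff_repr_inR2 frq.
split => [n|].
  (* Monotonicity is proved for every [n], including indices below [N], where the integral may be
     -oo. *)
  rewrite (int2_diff_repr (fpq n)) (int2_diff_repr (fpq n.+1)).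
  apply: diff_repr_le (fpq n) (fpq n.+1) _.
  by move/holds_aeP : f_cvg; apply: filterS => x [].
rewrite (int2_diff_repr frq) -(cvg_shiftn N).
by under eq_fun do rewrite (int2_diff_repr (fpq _)).
Qed.
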